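(* Let $G$ be a finite connected simple $(t+1)$-regular graph ($t\ge1$) and let $u\in\mathbb C$ with $u\ne 1,-t$. Then both $q=(t+u)^{-1}$ and $q=(1-u)^{-1}$ are poles of $q\mapsto\zeta_G(q,u)$, and the minimal and maximal moduli $r_G\le r'_G$ of the poles of $\zeta_G(\cdot,u)$ are \[ (r_G,r'_G)=\begin{cases}(|t+u|^{-1},|1-u|^{-1}) & \text{if } \operatorname{Re}u\ge -\frac{t-1}{2},\\ (|1-u|^{-1},|t+u|^{-1}) & \text{if } \operatorname{Re}u<-\frac{t-1}{2}.\end{cases} \]
   Context: $G$ has $n_V$ vertices and $n_E$ edges, adjacency matrix $A$. The Bartholdi zeta function is defined for small $|q|,|u|$ by the Euler product $\zeta_G(q,u)=\prod_{[C]}(1-q^{|C|}u^{b(C)})^{-1}$ over rotation-equivalence classes of primitive cycles (closed walks on directed edges), $|C|$ the length, $b(C)$ the number of bumps (consecutive traversal of an edge and its reverse, counted cyclically). For a $(t+1)$-regular graph it equals the rational function $(1-(1-u)^2q^2)^{-(n_E-n_V)}\det\bigl((1+(1-u)(t+u)q^2)I_{n_V}-qA\bigr)^{-1}$, and $\zeta_G(q,u)$ denotes this rational function. *)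

(* Defs.v *)
From HB Require Import structures.
From mathcomp Require Export all_boot all_order all_algebra.
From mathcomp Require Export fraction complex reals.

Set Implicit Arguments.
Unset Strict Implicit.
Unset Printing Implicit Defensive.

Import Order.TTheory GRing.Theory Num.Theory.
Local Open Scope ring_scope.

Local Notation "x %:F" := (tofrac x).

Section Graph.
Variables (V : finType) (e : rel V).

Definition is_simple : Prop := symmetric e /\ irreflexive e.

(* The null graph is not connected. *)
Definition is_connected : Prop :=
  (0 < #|V|)%N /\ forall x y : V, connect e x y.

Definition is_regular (k : nat) : Prop :=
  forall x : V, #|[set y | e x y]| = k.

Definition edge_set : {set {set V}} :=
  [set [set p.1; p.2] | p : V * V & e p.1 p.2].

Definition adjacency_mx (K : pzSemiRingType) : 'M[K]_#|V| :=
  \matrix_(i, j) (e (enum_val i) (enum_val j))%:R.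

(* The zeta function of a (t+1)-regular graph as a rational function of q
   (the indeterminate 'X) for fixed u. *)
Definition bartholdi_zeta (C : fieldType) (t : nat) (u : C) :
    {fraction {poly C}} :=
  (1 - ((1 - u) ^+ 2) *: 'X^2)%:F ^ (- (#|edge_set|%:Z - #|V|%:Z))
  * (\det ((1 + ((1 - u) * (t%:R + u)) *: 'X^2)%:M
           - 'X *: adjacency_mx {poly C}))%:F^-1.

End Graph.

(* A zero of the denominator of f written in lowest terms. *)
Definition is_pole (C : fieldType) (f : {fraction {poly C}}) (a : C) : Prop :=
  exists p d : {poly C},
    [/\ d != 0, coprimep p d, f = p%:F / d%:F & root d a].

Definition pole_moduli_range (C : numFieldType) (f : {fraction {poly C}})
    (r r' : C) : Prop :=
  [/\ exists2 a, is_pole f a & `|a| = r,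
      exists2 a, is_pole f a & `|a| = r'
    & forall a, is_pole f a -> r <= `|a| <= r'].

(* Main.v *)
Require Import Defs.
From HB Require Import structures.
From mathcomp Require Import all_boot all_order all_algebra.
From mathcomp Require Import fraction complex reals ring.

Set Implicit Arguments.
Unset Strict Implicit.
Unset Printing Implicit Defensive.

Import Order.TTheory GRing.Theory Num.Theory.
Local Open Scope ring_scope.

(** The zeta function is the reciprocal of a polynomial [D]: a [(t+1)]-regular
    graph with [t >= 1] has at least as many edges as vertices.  Its poles are
    therefore the roots of [D]. The roots of the first factor have modulus
    [|1 - u|^-1]. If [q] is a root of the determinant and [z = q^-1], then
    [z + a b / z] is an eigenvalue [l] of the adjacency matrix, where [a = 1 - u],
    [b = t + u], and [l] is real with [|l| <= s = t + 1 = a + b]; moreover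
    [l = s] is attained and gives [z = a] and [z = b].
    With [w = a b / z], the parallelogram law and the triangle inequality give
    [2 (|z|^2 + |w|^2) = l^2 + |l^2 - 4 a b| <= s^2 + |s^2 - 4 a b|
    = 2 (|a|^2 + |b|^2)], and since [|z w| = |a b|] this means
    [(|z|^2 - |a|^2) (|z|^2 - |b|^2) <= 0]. *)

Local Notation "x %:F" := (tofrac x).

(** * Reciprocals of polynomials, and the edge count *)

Lemma divf_eq_inv (F : fieldType) (x y d : F) :
  d != 0 -> y != 0 -> y^-1 = x / d -> d = x * y.
Proof.
move=> d0 y0 /(congr1 (fun w => w * d * y)).
by rewrite divfK // mulrAC mulVf // mul1r.
Qed.

(** If [1 / D = p / d], then [d = p * D], so a root of [p] would also be a root of [d], against
    coprimality. *)
Lemma is_pole_inv (C : fieldType) (D : {poly C}) (a : C) :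
  D != 0 -> is_pole (D%:F^-1) a <-> root D a.
Proof.
move=> D0; have DF0 : D%:F != 0 by rewrite tofrac_eq0.
split=> [[p [d [d0 cpd fE da]]]|Da]; last first.
  by exists 1, D; split; rewrite ?coprime1p // rmorph1 mul1r.
have dE : d = p * D.
  apply/eqP; rewrite -tofrac_eq tofracM; apply/eqP.
  have dF0 : d%:F != 0 by rewrite tofrac_eq0.
  exact: (divf_eq_inv dF0 DF0 fE).
move: da; rewrite dE rootM => /orP[pa|//].
have := coprimep_root cpd pa.
by rewrite dE hornerM (rootP pa) mul0r eqxx.
Qed.

(** Double counting of the ordered adjacent pairs: there are [#|V| * t.+1] of them, and at most two
    yield the same edge. *)
Lemma leq_card_edge_set (V : finType) (e : rel V) (t : nat) :
  (1 <= t)%N -> is_regular e t.+1 -> (#|V| <= #|edge_set e|)%N.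
Proof.
move=> t1 hreg.
pose A := [set p : V * V | e p.1 p.2].
have cardA : #|A| = (#|V| * t.+1)%N.
  rewrite -sum1_card (eq_bigl (fun p : V * V => e p.1 p.2)); last first.
    by move=> p; rewrite inE.
  rewrite -(pair_big_dep xpredT e (fun _ _ => 1%N)) /=.
  rewrite (eq_bigr (fun=> t.+1)) ?sum_nat_const // => x _.
  by rewrite -(hreg x) -sum1_card; apply: eq_bigl => y; rewrite inE.
have : (#|A| <= #|edge_set e| * 2)%N.
  rewrite -sum1_card.
  rewrite (partition_big (fun p : V * V => [set p.1; p.2])
             (fun E => E \in edge_set e)) /=; last first.
    by move=> p; rewrite inE => ep; apply/imsetP; exists p; rewrite ?inE.
  rewrite -sum_nat_const; apply: leq_sum => E /imsetP[[x y] /= _ ->].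
  rewrite sum1dep_card.
  apply: (@leq_trans #|[set (x, y); (y, x)]|); last by rewrite cards2; case: eqP.
  apply/subset_leq_card/subsetP => -[x' y']; rewrite !inE /= => /andP[_ /eqP eq2].
  have : x' \in [set x; y] by rewrite -eq2 !inE eqxx.
  have : y' \in [set x; y] by rewrite -eq2 !inE eqxx orbT.
  have : x \in [set x'; y'] by rewrite eq2 !inE eqxx.
  have : y \in [set x'; y'] by rewrite eq2 !inE eqxx orbT.
  rewrite !inE !xpair_eqE.
  by do 4![case/orP => /eqP ?]; subst; rewrite ?eqxx ?orbT.
rewrite cardA => le2; rewrite -(leq_pmul2r (isT : (0 < 2)%N)).
by apply: leq_trans le2; rewrite leq_mul2l ltnS t1 orbT.
Qed.

(** * Spectrum of the adjacency matrix of a regular graph *)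

Section Adjacency.
Variables (C : numClosedFieldType) (V : finType) (e : rel V) (k : nat).
Hypotheses (esym : symmetric e) (hreg : is_regular e k).
Local Notation A := (adjacency_mx e C).

Lemma adjacency_mx_row_sum i : \sum_j A i j = k%:R.
Proof.
rewrite -(hreg (enum_val i)) -sum1_card natr_sum.
rewrite (reindex_onto (@enum_rank V) (@enum_val V xpredT)) /=; last first.
  by move=> j _; rewrite enum_valK.
rewrite [RHS]big_mkcond [LHS]big_mkcond; apply: eq_bigr => y _.
by rewrite enum_rankK eqxx mxE enum_rankK inE; case: ifP.
Qed.

Lemma adjacency_mxC i j : A i j = A j i.
Proof. by rewrite !mxE esym. Qed.

(** Realness: the Hermitian form of [A] at [v] equals [l * N], with [N] the squared norm of [v], and
    is self-conjugate. Bound: the eigenvalue equation is estimated in the [l^1] norm, where every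
    row of [A] contributes [k]. *)
Lemma adjacency_eigenvalue_bound (v : 'rV[C]_#|V|) (l : C) :
  v != 0 -> v *m A = l *: v -> l \is Num.real /\ `|l| <= k%:R.
Proof.
move=> v0 vA.
have [j0 vj0] : exists j, v 0 j != 0.
  apply/existsP; rewrite -negb_forall; apply: contraNN v0 => /forallP h.
  by apply/eqP/rowP=> j; rewrite mxE; apply/eqP/h.
have vAE j : \sum_i v 0 i * A i j = l * v 0 j.
  by have /rowP/(_ j) := vA; rewrite !mxE.
split.
  pose N := \sum_j v 0 j * (v 0 j)^*.
  have N0 : 0 < N.
    rewrite /N (bigD1 j0) //= ltr_wpDr ?sumr_ge0 // => [i _|].
      by rewrite -normCK exprn_ge0.
    by rewrite -normCK exprn_gt0 // normr_gt0.
  have hE : \sum_j \sum_i v 0 i * A i j * (v 0 j)^* = l * N.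
    rewrite mulr_sumr; apply: eq_bigr => j _.
    by rewrite -mulr_suml vAE mulrA.
  have : (l * N)^* = l * N.
    rewrite -hE [RHS]exchange_big rmorph_sum /=; apply: eq_bigr => j _.
    rewrite rmorph_sum; apply: eq_bigr => i _ /=.
    rewrite !rmorphM /= conjCK adjacency_mxC [A j i]mxE conjC_nat; ring.
  rewrite rmorphM /= (CrealP (gtr0_real N0)) => /(mulIf (lt0r_neq0 N0)) lE.
  by apply/CrealP.
have S0 : 0 < \sum_j `|v 0 j|.
  rewrite (bigD1 j0) //= ltr_wpDr ?sumr_ge0 //.
  by rewrite normr_gt0.
rewrite -(ler_pM2r S0).
have -> : `|l| * \sum_j `|v 0 j| = \sum_j `|\sum_i v 0 i * A i j|.
  by rewrite mulr_sumr; apply: eq_bigr => j _; rewrite vAE normrM.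
apply: (@le_trans _ _ (\sum_j \sum_i `|v 0 i| * A i j)).
  apply: ler_sum => j _; apply: le_trans (ler_norm_sum _ _ _) _.
  by apply: ler_sum => i _; rewrite normrM [A i j]mxE normr_nat.
rewrite exchange_big /= mulr_sumr; apply: ler_sum => i _.
by rewrite -mulr_sumr adjacency_mx_row_sum mulrC.
Qed.

Lemma det_adjacency_regular_eq0 (c q : C) :
  (0 < #|V|)%N -> c = q * k%:R -> \det (c%:M - q *: A) = 0.
Proof.
(* The all-ones vector is an eigenvector for [k]. It acts from the left, giving column sums, which
   symmetry turns into row sums. *)
move=> V0 cE; apply/eqP/det0P; exists (const_mx 1).
  apply/eqP => /rowP/(_ (Ordinal V0)); rewrite !mxE => /eqP.
  by rewrite oner_eq0.
apply/rowP => j; rewrite mulmxBr mul_mx_scalar -scalemxAr.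
rewrite [X in _ = X]mxE [LHS]mxE [X in X + _]mxE [X in _ + X]mxE [X in - X]mxE.
rewrite [(const_mx 1 *m A) 0 j]mxE.
rewrite (eq_bigr (fun i => A j i)) => [|i _]; last first.
  by rewrite adjacency_mxC [X in X * _]mxE mul1r.
by rewrite adjacency_mx_row_sum mxE cE mulr1 subrr.
Qed.

End Adjacency.

(** * Moduli of the roots of a quadratic *)

Lemma quadratic_root_norm_bound (C : numClosedFieldType) (a b z w l s : C) :
  l \is Num.real -> `|l| <= s -> s = a + b -> l = z + w -> z * w = a * b ->
  (`|z| ^+ 2 - `|a| ^+ 2) * (`|z| ^+ 2 - `|b| ^+ 2) <= 0.
Proof.
move=> lr ls sE lE pE.
have s_ge0 : 0 <= s by apply: le_trans ls.
have parallelogram (x y : C) :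
    `|x| ^+ 2 + `|y| ^+ 2 = (`|x + y| ^+ 2 + `|(x + y) ^+ 2 - 4 * (x * y)|) / 2.
  have -> : (x + y) ^+ 2 - 4 * (x * y) = (x - y) ^+ 2 by ring.
  by rewrite normrX !normCK !rmorphD rmorphN /=; field.
have l2s2 : `|l| ^+ 2 <= s ^+ 2 by rewrite ler_pXn2r ?nnegrE ?normr_ge0.
have sum_le : `|z| ^+ 2 + `|w| ^+ 2 <= `|a| ^+ 2 + `|b| ^+ 2.
  rewrite !parallelogram -lE -sE pE ler_pM2r ?invr_gt0 ?ltr0n //.
  rewrite (ger0_norm s_ge0).
  (* Since [l] is real, [l ^+ 2 = |l|^2]; the subtracted term is then a nonnegative real, and the
     triangle inequality costs exactly what [|l|^2] falls short of [s ^+ 2]. *)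
  have -> : l ^+ 2 - 4 * (a * b) =
            (s ^+ 2 - 4 * (a * b)) - (s ^+ 2 - `|l| ^+ 2).
    by rewrite real_normK //; ring.
  rewrite -lerBrDl; apply: le_trans (ler_normB _ _) _.
  rewrite [`|s ^+ 2 - `|l| ^+ 2|]ger0_norm ?subr_ge0 //.
  by rewrite -[leRHS]addrA addrCA.
have prod_eq : `|z| ^+ 2 * `|w| ^+ 2 = `|a| ^+ 2 * `|b| ^+ 2.
  by rewrite -!exprMn -!normrM pE.
(* Replacing the constant term [|a|^2 |b|^2] by [|z|^2 |w|^2] lets [|z|^2] factor out. *)
have -> : (`|z| ^+ 2 - `|a| ^+ 2) * (`|z| ^+ 2 - `|b| ^+ 2) =
   `|z| ^+ 2 * ((`|z| ^+ 2 + `|w| ^+ 2) - (`|a| ^+ 2 + `|b| ^+ 2)).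
  transitivity (`|z| ^+ 2 * (`|z| ^+ 2 - (`|a| ^+ 2 + `|b| ^+ 2))
                + `|a| ^+ 2 * `|b| ^+ 2); first by ring.
  by rewrite -prod_eq; ring.
by rewrite mulr_ge0_le0 ?exprn_ge0 // subr_le0.
Qed.

Lemma norm_between (C : numClosedFieldType) (a b z : C) :
  `|a| <= `|b| -> (`|z| ^+ 2 - `|a| ^+ 2) * (`|z| ^+ 2 - `|b| ^+ 2) <= 0 ->
  `|a| <= `|z| <= `|b|.
Proof.
move=> ab H.
(* The order on [C] is partial, so negating [<=] requires both sides to be real. Outside the
   interval the two factors have the same strict sign. *)
have lt_norm (x y : C) : ~~ (`|x| <= `|y|) -> `|y| < `|x|.
  by rewrite -real_ltNge // normr_real.
have sqr (x y : C) : `|x| < `|y| -> 0 < `|y| ^+ 2 - `|x| ^+ 2.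
  by move=> xy; rewrite subr_gt0 ltr_pXn2r ?nnegrE ?normr_ge0.
apply/andP; split; apply/negPn/negP => /lt_norm h; move: H; apply/negP.
  rewrite -real_ltNge ?rpredM ?rpredB ?rpredX ?normr_real ?real0 //.
  by rewrite -mulrNN !opprB mulr_gt0 // sqr // (lt_le_trans h).
rewrite -real_ltNge ?rpredM ?rpredB ?rpredX ?normr_real ?real0 //.
by rewrite mulr_gt0 // sqr // (le_lt_trans ab).
Qed.

(** * Poles of the zeta function *)

Section Poles.
Variables (C : numClosedFieldType) (V : finType) (e : rel V) (t : nat) (u : C).
Hypotheses (t1 : (1 <= t)%N) (esym : symmetric e) (V0 : (0 < #|V|)%N).
Hypothesis hreg : is_regular e t.+1.
Hypotheses (u1 : 1 - u != 0) (ut : t%:R + u != 0).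

Lemma bartholdi_zeta_poleP (q : C) :
  is_pole (bartholdi_zeta e t u) q <->
  ((0 < #|edge_set e| - #|V|)%N && (((1 - u) * q) ^+ 2 == 1)) ||
  (\det ((1 + (1 - u) * (t%:R + u) * q ^+ 2)%:M - q *: adjacency_mx e C) == 0).
Proof.
pose f : {poly C} := 1 - ((1 - u) ^+ 2) *: 'X^2.
pose g : {poly C} := \det ((1 + ((1 - u) * (t%:R + u)) *: 'X^2)%:M
           - 'X *: adjacency_mx e {poly C}).
pose m := (#|edge_set e| - #|V|)%N.
have fE x : f.[x] = 1 - ((1 - u) * x) ^+ 2.
  by rewrite /f !hornerE /=; ring.
have gE x : g.[x] = \det ((1 + (1 - u) * (t%:R + u) * x ^+ 2)%:M
                          - x *: adjacency_mx e C).
  rewrite -[g.[x]]/(horner_eval x g) /g -det_map_mx.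
  congr (\det _); apply/matrixP => i j; rewrite !mxE /= /horner_eval.
  by case: (i == j); case: (e _ _); rewrite ?mulr1n ?mulr0n !hornerE /=; ring.
have zE : bartholdi_zeta e t u = ((f ^+ m * g)%:F)^-1.
  rewrite /bartholdi_zeta -/f -/g tofracM invfM subzn ?(leq_card_edge_set t1 hreg) //.
  by rewrite -/m -invr_expz -exprnP tofracXn.
(* The denominator is nonzero because its value at 0 is 1. *)
rewrite zE is_pole_inv; last first.
  apply/eqP => /(congr1 (horner^~ 0)).
  rewrite hornerM horner_exp fE gE horner0 mulr0 expr0n /= subr0 expr1n mul1r.
  rewrite mulr0 addr0 scale0r subr0 det1 => /eqP.
  by rewrite oner_eq0.
by rewrite rootM rootE horner_exp expf_eq0 fE rootE gE subr_eq0 [1 == _]eq_sym.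
Qed.

(** With [a = 1 - u] and [b = t + u], the point [q = b^-1] satisfies [1 + a b q^2 = q (a + b)], and
    [a + b = t + 1] is the degree. *)
Lemma bartholdi_pole_tu : is_pole (bartholdi_zeta e t u) (t%:R + u)^-1.
Proof.
apply/bartholdi_zeta_poleP; apply/orP; right; apply/eqP.
apply: (det_adjacency_regular_eq0 esym hreg) => //.
by rewrite -natr1; field.
Qed.

(** Again a root of the determinant: the first factor would not do, as its exponent is zero for a
    cycle graph. *)
Lemma bartholdi_pole_1u : is_pole (bartholdi_zeta e t u) (1 - u)^-1.
Proof.
apply/bartholdi_zeta_poleP; apply/orP; right; apply/eqP.
apply: (det_adjacency_regular_eq0 esym hreg) => //.
by rewrite -natr1; field.
Qed.

Lemma bartholdi_pole_bound (q : C) : is_pole (bartholdi_zeta e t u) q ->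
  q != 0 /\ (`|q^-1| ^+ 2 - `|1 - u| ^+ 2) * (`|q^-1| ^+ 2 - `|t%:R + u| ^+ 2) <= 0.
Proof.
move=> /bartholdi_zeta_poleP/orP[/andP[_ /eqP q2]|/det0P[v v0]].
  have q0 : q != 0.
    by apply/eqP => qE; move/eqP: q2; rewrite qE mulr0 expr0n eq_sym oner_eq0.
  split=> //; have -> : `|q^-1| ^+ 2 = `|1 - u| ^+ 2.
    rewrite -!normrX; congr (`|_|); apply: (mulIf (expf_neq0 2 q0)).
    by rewrite -!exprMn q2 mulVf // expr1n.
  by rewrite subrr mul0r.
rewrite mulmxBr mul_mx_scalar -scalemxAr => /eqP; rewrite subr_eq0 => /eqP vE.
have q0 : q != 0.
  apply/eqP => qE; move: vE; rewrite qE expr0n mulr0 addr0 scale1r scale0r.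
  by move/eqP; rewrite (negPf v0).
split=> //; set c := 1 + _ in vE.
(* Dividing the kernel equation by [q] makes [q^-1 * c], that is [z + a b / z] with [z = q^-1], an
   eigenvalue. *)
have [lr lb] : q^-1 * c \is Num.real /\ `|q^-1 * c| <= t.+1%:R.
  apply: (adjacency_eigenvalue_bound esym hreg v0).
  by rewrite -scalerA vE scalerA mulVf // scale1r.
apply: (@quadratic_root_norm_bound _ _ _ _ ((1 - u) * (t%:R + u) * q) _ _ lr lb).
- by rewrite -natr1; ring.
- by rewrite /c; field.
- by field.
Qed.

End Poles.

(** The imaginary parts cancel: [|t + u|^2 - |1 - u|^2 = 2 (t + 1) (Re u + (t - 1) / 2)]. *)
Lemma norm_1Bu_le (R : realType) (t : nat) (u : R[i]) :
  (`|1 - u| <= `|t%:R + u|) = (- ((t%:R - 1) / 2) <= complex.Re u).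
Proof.
rewrite -(@ler_pXn2r _ 2) ?nnegrE ?normr_ge0 // -!add_Re2_Im2 lecR.
have -> : (t%:R : R[i]) = (t%:R : R)%:C%C by rewrite rmorph_nat.
case: u => x y /=; rewrite -subr_ge0.
have -> : (t%:R + x) ^+ 2 + (0 + y) ^+ 2 - ((1 - x) ^+ 2 + (0 - y) ^+ 2)
          = (t%:R + 1) * 2 * (x + (t%:R - 1) / 2) :> R by field.
by rewrite pmulr_rge0 ?mulr_gt0 ?ltr_wpDl ?ler0n ?ltr0n // -lerBlDr sub0r.
Qed.

Theorem theorem4p4 (R : realType) (V : finType) (e : rel V) (t : nat) (u : R[i])
    (ht : (1 <= t)%N)
    (hsimple : is_simple e) (hconn : is_connected e) (hreg : is_regular e t.+1)
    (hu1 : u <> 1) (hut : u <> - t%:R) :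
  [/\ is_pole (bartholdi_zeta e t u) (t%:R + u)^-1,
      is_pole (bartholdi_zeta e t u) (1 - u)^-1,
      - ((t%:R - 1) / 2) <= complex.Re u ->
        pole_moduli_range (bartholdi_zeta e t u) `|t%:R + u|^-1 `|1 - u|^-1
    & complex.Re u < - ((t%:R - 1) / 2) ->
        pole_moduli_range (bartholdi_zeta e t u) `|1 - u|^-1 `|t%:R + u|^-1].
Proof.
have [[esym _] [V0 _]] := (hsimple, hconn).
have u1 : 1 - u != 0 by rewrite subr_eq0 eq_sym; apply/eqP.
have ut : t%:R + u != 0 by rewrite addrC addr_eq0; apply/eqP.
have ptu := bartholdi_pole_tu ht esym V0 hreg ut.
have p1u := bartholdi_pole_1u ht esym V0 hreg u1.
have bound := bartholdi_pole_bound ht esym hreg.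
split=> //.
  rewrite -norm_1Bu_le => le_ab; split.
  - by exists (t%:R + u)^-1; rewrite ?normfV.
  - by exists (1 - u)^-1; rewrite ?normfV.
  move=> q /bound[q0 /(norm_between le_ab)/andP[h1 h2]].
  rewrite -[q]invrK normfV !lef_pV2 ?posrE ?normr_gt0 ?invr_eq0 //.
  by rewrite h2 h1.
rewrite ltNge -norm_1Bu_le -real_ltNge ?normr_real // => /ltW le_ba; split.
- by exists (1 - u)^-1; rewrite ?normfV.
- by exists (t%:R + u)^-1; rewrite ?normfV.
(* The bound is symmetric in [1 - u] and [t + u], so swapping its factors serves the opposite
   ordering; inverting [q^-1] then reverses the inequalities. *)
move=> q /bound[q0]; rewrite mulrC => /(norm_between le_ba)/andP[h1 h2].
rewrite -[q]invrK normfV !lef_pV2 ?posrE ?normr_gt0 ?invr_eq0 //.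
by rewrite h2 h1.
Qed.
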